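(* Let $\mathcal{A}$ be a Banach algebra and $\mathcal{X}$ be a Banach $\mathcal{A}$-bimodule. If $\mathcal{A}$ is faithful and $\mathcal{X}$ is $\mathcal{A}$-faithful, then the module product algebra $\mathcal{A} \times_m \mathcal{X}$ is faithful.
   Context: Algebras are associative algebras over $\mathbb{C}$ (not assumed unital or commutative). An algebra $\mathcal{A}$ is faithful if the only $a \in \mathcal{A}$ with $ab = 0$ for all $b \in \mathcal{A}$ is $a = 0$. An $\mathcal{A}$-bimodule $\mathcal{X}$ is $\mathcal{A}$-faithful if the only $x \in \mathcal{X}$ with $xa = 0$ for all $a \in \mathcal{A}$ is $x = 0$. For a Banach algebra $\mathcal{A}$ and a Banach $\mathcal{A}$-bimodule $\mathcal{X}$, the module product algebra $\mathcal{A} \times_m \mathcal{X}$ is the vector space $\mathcal{A} \times \mathcal{X}$ with coordinatewise linear operations and the product $(a,x) \times_m (b,y) = (ab, ay + xb)$. *)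

(* Defs.v *)
From HB Require Import structures.
From mathcomp Require Import all_boot all_order all_algebra.
From mathcomp Require Import complex.
From mathcomp Require Import all_classical all_reals all_analysis.

Set Implicit Arguments.
Unset Strict Implicit.
Unset Printing Implicit Defensive.

Import Order.TTheory GRing.Theory Num.Theory.
Import numFieldNormedType.Exports.

Local Open Scope ring_scope.

(* [GRing.Algebra] is unital, hence the separate hierarchy below. The product
   is written [amul]; the ring notation [*] is not available on these types. *)
HB.mixin Record isAssocAlgebra (K : fieldType) A of GRing.Lmodule K A := {
  amul : A -> A -> A;
  amulA : associative amul;
  amulDl : left_distributive amul +%R;
  amulDr : right_distributive amul +%R;
  amulZl : forall (k : K) (a b : A), amul (k *: a) b = k *: amul a b;
  amulZr : forall (k : K) (a b : A), amul a (k *: b) = k *: amul a b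
}.

#[short(type="assocAlgType")]
HB.structure Definition AssocAlgebra (K : fieldType) :=
  {A of isAssocAlgebra K A & GRing.Lmodule K A}.

HB.mixin Record isBimodule (K : fieldType) (A : assocAlgType K) X
    of GRing.Lmodule K X := {
  lact : A -> X -> X;
  ract : X -> A -> X;
  lactDl : forall (a b : A) (x : X), lact (a + b) x = lact a x + lact b x;
  lactDr : forall (a : A) (x y : X), lact a (x + y) = lact a x + lact a y;
  lactZl : forall (k : K) (a : A) (x : X), lact (k *: a) x = k *: lact a x;
  lactZr : forall (k : K) (a : A) (x : X), lact a (k *: x) = k *: lact a x;
  ractDl : forall (x y : X) (a : A), ract (x + y) a = ract x a + ract y a;
  ractDr : forall (x : X) (a b : A), ract x (a + b) = ract x a + ract x b;
  ractZl : forall (k : K) (x : X) (a : A), ract (k *: x) a = k *: ract x a;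
  ractZr : forall (k : K) (x : X) (a : A), ract x (k *: a) = k *: ract x a;
  lactA : forall (a b : A) (x : X), lact (amul a b) x = lact a (lact b x);
  ractA : forall (x : X) (a b : A), ract x (amul a b) = ract (ract x a) b;
  lractA : forall (a : A) (x : X) (b : A),
    ract (lact a x) b = lact a (ract x b)
}.

#[short(type="bimodType")]
HB.structure Definition Bimodule (K : fieldType) (A : assocAlgType K) :=
  {X of isBimodule K A X & GRing.Lmodule K X}.

HB.mixin Record AssocAlgebra_isBanach (K : numFieldType) A
    of AssocAlgebra K A & CompleteNormedModule K A := {
  normr_amul : forall a b : A, `|amul a b| <= `|a| * `|b|
}.

#[short(type="banachAlgType")]
HB.structure Definition BanachAlgebra (K : numFieldType) :=
  {A of AssocAlgebra K A & CompleteNormedModule K A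
      & AssocAlgebra_isBanach K A}.

(* The actions are only required to be bounded, which includes the convention
   in which they are contractive. *)
HB.mixin Record Bimodule_isBanach (K : numFieldType) (A : banachAlgType K) X
    of Bimodule K A X & CompleteNormedModule K X := {
  lact_bounded : exists M : K,
    forall (a : A) (x : X), `|lact a x| <= M * (`|a| * `|x|);
  ract_bounded : exists M : K,
    forall (x : X) (a : A), `|ract x a| <= M * (`|x| * `|a|)
}.

#[short(type="banachBimodType")]
HB.structure Definition BanachBimodule (K : numFieldType)
    (A : banachAlgType K) :=
  {X of Bimodule K A X & CompleteNormedModule K X & Bimodule_isBanach K A X}.

Definition faithful (K : fieldType) (A : assocAlgType K) : Prop :=
  forall a : A, (forall b : A, amul a b = 0) -> a = 0.

Definition bimod_faithful (K : fieldType) (A : assocAlgType K)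
    (X : bimodType A) : Prop :=
  forall x : X, (forall a : A, ract x a = 0) -> x = 0.

(* An alias of [A * X], so that its product does not compete with the
   coordinatewise one. *)
Definition module_product (K : fieldType) (A : assocAlgType K)
    (X : bimodType A) : Type := (A * X)%type.

Section ModuleProduct.
Variables (K : fieldType) (A : assocAlgType K) (X : bimodType A).

HB.instance Definition _ := GRing.Lmodule.copy (module_product X) (A * X)%type.

Definition mpmul (u v : module_product X) : module_product X :=
  (amul u.1 v.1, lact u.1 v.2 + ract u.2 v.1).

Fact mpmulA : associative mpmul.
Proof.
move=> [a x] [b y] [c z]; rewrite /mpmul /= amulA; congr pair.
by rewrite lactDr ractDl lactA ractA lractA addrA.
Qed.

Fact mpmulDl : left_distributive mpmul +%R.
Proof.
move=> [a x] [b y] [c z]; rewrite /mpmul /= amulDl; congr pair.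
by rewrite lactDl ractDl addrACA.
Qed.

Fact mpmulDr : right_distributive mpmul +%R.
Proof.
move=> [a x] [b y] [c z]; rewrite /mpmul /= amulDr; congr pair.
by rewrite lactDr ractDr addrACA.
Qed.

Fact mpmulZl (k : K) (u v : module_product X) :
  mpmul (k *: u) v = k *: mpmul u v.
Proof.
case: u v => [a x] [b y]; rewrite /mpmul /= amulZl; congr pair.
by rewrite lactZl ractZl scalerDr.
Qed.

Fact mpmulZr (k : K) (u v : module_product X) :
  mpmul u (k *: v) = k *: mpmul u v.
Proof.
case: u v => [a x] [b y]; rewrite /mpmul /= amulZr; congr pair.
by rewrite lactZr ractZr scalerDr.
Qed.

HB.instance Definition _ := isAssocAlgebra.Build K (module_product X)
  mpmulA mpmulDl mpmulDr mpmulZl mpmulZr.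

End ModuleProduct.

(* Main.v *)
Require Import Defs.
From mathcomp Require Import all_boot all_order all_algebra.
From mathcomp Require Import complex.
From mathcomp Require Import all_classical all_reals all_analysis.

Local Open Scope ring_scope.

(** If [(a, x)] annihilates the module product from the left, multiplying it by elements [(b, 0)]
    already gives [ab = 0] and [xb = 0] for every [b]. Faithfulness of [A] then forces [a = 0], and
    that of [X] forces [x = 0]. *)

Lemma lact0r (K : fieldType) (A : assocAlgType K) (X : bimodType A) (a : A) :
  lact a (0 : X) = 0.
Proof. by rewrite -(GRing.scale0r (0 : X)) lactZr !GRing.scale0r. Qed.

Lemma module_product_faithful (K : fieldType) (A : assocAlgType K)
    (X : bimodType A) :
  faithful A -> bimod_faithful X -> faithful (module_product X).
Proof.
move=> fA fX [a x] annax.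
have annE (b : A) : amul a b = 0 /\ ract x b = 0.
  (* The second coordinate of the product is [lact a 0 + ract x b]; the choice of [0] removes the
     left action and isolates [ract x b]. *)
  by case: (annax (b, 0)) => ab0; rewrite /= lact0r GRing.add0r.
by congr pair; [apply: fA | apply: fX] => b; case: (annE b).
Qed.

Theorem lemma2p14 (R : realType) (A : banachAlgType R[i])
    (X : banachBimodType A) :
  faithful A -> bimod_faithful X -> faithful (module_product X).
Proof. exact: module_product_faithful. Qed.
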